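(* Let $1<p\le2$, $q=p/(p-1)$, $0<\epsilon<1$, $0<\delta<1/2$, and $n\ge1/\epsilon^q$. Any algorithm that solves the uniformity testing problem for $\ell_p$ distance with tolerance $\epsilon$ and failure probability $\delta$ on support size $n$ must draw at least \[ m=\sqrt{2(1-2\delta)\frac{1}{(2\epsilon)^q}}\] samples.
   Context: A distribution on support size $n$ is a vector $A\in\mathbb{R}^n$, $A_i\ge0$, $\sum_iA_i=1$; $U_n$ is uniform; $\|V\|_p=(\sum_i|V_i|^p)^{1/p}$. Uniformity testing: given $p,n,\epsilon,\delta$ and i.i.d. samples from an unknown distribution $A$ on $\{1,\dots,n\}$, the algorithm draws $m$ samples and must output ``uniform'' with probability at least $1-\delta$ if $A=U_n$, and ``not uniform'' with probability at least $1-\delta$ if $\|A-U_n\|_p\ge\epsilon$.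
   Formalization: Added assumption: some distribution A on n points has ‖A−U_n‖_p ≥ ε. Without it the claim fails: for p=2, n=2, ε=4/5 no distribution is that far, so drawing 0 samples and always answering ''uniform'' is correct. *)

(* Defs.v *)
From mathcomp Require Import all_boot all_order all_algebra.
From mathcomp Require Import all_classical all_reals all_analysis.

Set Implicit Arguments.
Unset Strict Implicit.
Unset Printing Implicit Defensive.

Import Order.TTheory GRing.Theory Num.Theory.

Local Open Scope ring_scope.

Definition is_distr (R : realType) (T : finType) (A : {ffun T -> R}) : Prop :=
  (forall i, 0 <= A i) /\ \sum_i A i = 1.

Definition unif (R : realType) (n : nat) : {ffun 'I_n -> R} :=
  [ffun=> n%:R^-1].

Definition lpnorm (R : realType) (n : nat) (p : R) (V : {ffun 'I_n -> R}) : R :=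
  (\sum_i `|V i| `^ p) `^ p^-1.

(* A possibly randomized algorithm drawing [m] samples is given by the law of
   its output conditionally on each sample sequence; the output [true] means
   "uniform" and [false] means "not uniform". *)
Definition algorithm (R : realType) (n m : nat) : Type :=
  m.-tuple 'I_n -> {ffun bool -> R}.

Definition is_algorithm (R : realType) (n m : nat) (T : algorithm R n m) : Prop :=
  forall s, is_distr (T s).

(* Probability that the m samples drawn i.i.d. from A are exactly s. *)
Definition iid_prob (R : realType) (n m : nat) (A : {ffun 'I_n -> R})
    (s : m.-tuple 'I_n) : R :=
  \prod_(j < m) A (tnth s j).

Definition output_prob (R : realType) (n m : nat) (T : algorithm R n m)
    (A : {ffun 'I_n -> R}) (b : bool) : R :=
  \sum_(s : m.-tuple 'I_n) iid_prob A s * T s b.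

Definition lp_far (R : realType) (n : nat) (p eps : R)
    (A : {ffun 'I_n -> R}) : Prop :=
  is_distr A /\ eps <= lpnorm p (A - unif R n).

Definition solves_uniformity_testing (R : realType) (n m : nat)
    (p eps delta : R) (T : algorithm R n m) : Prop :=
  1 - delta <= output_prob T (unif R n) true /\
  forall A : {ffun 'I_n -> R}, lp_far p eps A ->
    1 - delta <= output_prob T A false.

(* Main.v *)
(** The tester cannot distinguish [U_n] from a randomly relabelled copy of a
    fixed distribution [A] unless two samples coincide: averaged over all
    relabellings, every sequence of distinct samples has the same probability,
    just as under [U_n].  Two samples coincide with probability at most
    ['C(m, 2) * \sum_i A_i ^ 2], so this quantity is at least [1 - 2 delta]
    whenever [A] is [eps]-far from uniform.

    Take [A] uniform on [k] points, where [k] is the integer part of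
    [K := 1 / (2 eps) ^ q]; then [m (m - 1) >= 2 (1 - 2 delta) k].  This forces
    [m >= 2], so [m ^ 2 >= 2 (1 - 2 delta) (k + 1)], which absorbs the rounding
    of [K].  If [K < 1], use [k = 1] instead: by convexity a point mass is the
    farthest distribution from uniform, so it is far if anything is. *)
Require Import Defs.
From mathcomp Require Import all_boot all_order all_algebra.
From mathcomp Require Import fingroup perm action primitive_action alt.
From mathcomp Require Import all_classical all_reals all_analysis.
From mathcomp Require Import ring lra.

Set Implicit Arguments.
Unset Strict Implicit.
Unset Printing Implicit Defensive.

Import Order.TTheory GRing.Theory Num.Theory.

Local Open Scope ring_scope.

(** * Sequences of samples and their probabilities *)

(** The symmetric group of [T] is [#|T|]-transitive, hence [m]-transitive, as a repetition-free [s]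
    forces [m <= #|T|]. *)
Lemma perm_of_uniq_tuples (T : finType) (m : nat) (s t : m.-tuple T) :
  uniq s -> uniq t ->
  exists g : {perm T}, forall j, tnth t j = g (tnth s j).
Proof.
move=> us ut.
have dt (r : m.-tuple T) : uniq r -> r \in dtuple_on m [set: T]%SET.
  by move=> /tuple_uniqP injr; apply/dtuple_onP; split=> // i; rewrite finset.in_setT.
have mT : (m <= #|T|)%N.
  rewrite -[m](card_ord m); exact: (leq_card (tnth s) (elimT (tuple_uniqP s) us)).
have [g _ ->] := atransP2 (ntransitive_weak mT (Sym_trans T)) (dt s us) (dt t ut).
by exists g => j; rewrite tnth_map.
Qed.

(** Distributivity, with tuples seen as functions on ['I_m]. The factor may depend on the position,
    so that single samples can be constrained. *)
Lemma sum_tuple_prod (R : realType) (T : finType) (m : nat) (F : 'I_m -> T -> R) :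
  \sum_(s : m.-tuple T) \prod_(j < m) F j (tnth s j) =
  \prod_(j < m) \sum_x F j x.
Proof.
rewrite bigA_distr_bigA /=.
rewrite (reindex (fun f : {ffun 'I_m -> T} => [tuple f i | i < m])) /=; last first.
  exists (fun s : m.-tuple T => [ffun i => tnth s i]) => s _.
    by apply/ffunP=> i; rewrite ffunE tnth_mktuple.
  by apply: eq_from_tnth => i; rewrite tnth_mktuple ffunE.
by apply: eq_bigr => f _; apply: eq_bigr => i _; rewrite tnth_mktuple.
Qed.

Lemma iid_prob_ge0 (R : realType) (n m : nat) (A : {ffun 'I_n -> R})
    (s : m.-tuple 'I_n) : is_distr A -> 0 <= iid_prob A s.
Proof. by case=> A0 _; apply: prodr_ge0. Qed.

Lemma sum_iid_prob (R : realType) (n m : nat) (A : {ffun 'I_n -> R}) :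
  is_distr A -> \sum_(s : m.-tuple 'I_n) iid_prob A s = 1.
Proof. by case=> _ A1; rewrite (sum_tuple_prod (fun=> A)) big1. Qed.

(** * Probability of a collision *)

Lemma pair_collision_prob (R : realType) (n m : nat) (A : {ffun 'I_n -> R})
    (i j : 'I_m) :
  is_distr A -> i != j ->
  \sum_(s : m.-tuple 'I_n | tnth s i == tnth s j) iid_prob A s =
  \sum_x A x ^+ 2.
Proof.
move=> [_ A1] ij; have ji : j != i by rewrite eq_sym.
(* The indicator forces samples [i] and [j] to equal [x] and leaves the others free, so after
   splitting by the common value [x] the sum factors over positions. *)
pose F x (l : 'I_m) y := A y * ((l == i) || (l == j) ==> (y == x))%:R.
have pick x : \sum_y A y * (y == x)%:R = A x.
  rewrite (bigD1 x) //= eqxx mulr1 big1 ?addr0 // => y /negPf ->.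
  by rewrite mulr0.
transitivity (\sum_x \sum_(s : m.-tuple 'I_n) \prod_(l < m) F x l (tnth s l)).
  rewrite exchange_big /= big_mkcond; apply: eq_bigr => s _.
  have E x : \prod_(l < m) F x l (tnth s l) =
      iid_prob A s * (tnth s j == x)%:R * (tnth s i == x)%:R.
    rewrite /iid_prob /F (bigD1 i) // (bigD1 j) //= !eqxx orbT /=.
    rewrite [in RHS](bigD1 i) // [in RHS](bigD1 j) //=.
    rewrite (eq_bigr (fun l => A (tnth s l))); last first.
      by move=> l /andP[/negPf -> /negPf ->] /=; rewrite mulr1.
    by rewrite /=; ring.
  rewrite (eq_bigr _ (fun x _ => E x)) (bigD1 (tnth s i)) //= eqxx mulr1.
  rewrite big1 ?addr0; last by move=> x /negPf; rewrite eq_sym => ->; rewrite mulr0.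
  by rewrite [tnth s j == _]eq_sym; case: eqP => _ /=; rewrite ?mulr1 ?mulr0.
apply: eq_bigr => x _; rewrite sum_tuple_prod (bigD1 i) //= (bigD1 j) //=.
rewrite /F !eqxx orbT /= !pick big1 ?mulr1 ?expr2 // => l /andP[/negPf -> /negPf ->].
by rewrite /= -[RHS]A1; apply: eq_bigr => y _; rewrite mulr1.
Qed.

(** Union bound over the pairs of positions [i < j]. *)
Lemma collision_prob (R : realType) (n m : nat) (A : {ffun 'I_n -> R}) :
  is_distr A ->
  \sum_(s : m.-tuple 'I_n | ~~ uniq s) iid_prob A s <=
  'C(m, 2)%:R * \sum_x A x ^+ 2.
Proof.
move=> dA.
have -> : 'C(m, 2)%:R * \sum_x A x ^+ 2 =
    \sum_(j < m) \sum_(i < m | (i < j)%N) \sum_(s : m.-tuple 'I_n)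
      if tnth s i == tnth s j then iid_prob A s else 0.
  transitivity (\sum_(j < m) (\sum_x A x ^+ 2) *+ j).
    by rewrite mulr_natl -bin2_sum big_mkord -sumrMnr.
  apply: eq_bigr => j _.
  rewrite [RHS](eq_bigr (fun=> \sum_x A x ^+ 2)).
    by rewrite (big_ord_narrow (ltnW (ltn_ord j))) sumr_const card_ord.
  move=> i ij; rewrite -big_mkcond pair_collision_prob //.
  by apply: contraTneq ij => ->; rewrite ltnn.
under [leRHS]eq_bigr do rewrite exchange_big /=.
rewrite [leRHS]exchange_big big_mkcond /=; apply: ler_sum => s _.
have P0 := iid_prob_ge0 s dA.
have Q0 i j : 0 <= if tnth s i == tnth s j then iid_prob A s else 0.
  by case: ifP.
case: ifPn => [us|_]; last by apply: sumr_ge0 => j _; apply: sumr_ge0.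
have [i [j [ij sij]]] : exists i j : 'I_m, (i < j)%N /\ tnth s i = tnth s j.
  have [i [j [ij sij]]] : exists i j : 'I_m, i != j /\ tnth s i = tnth s j.
    apply: contrapT => H; move/negP: us; apply; apply/tuple_uniqP => i j sij.
    by apply/eqP; apply: contrapT => /negP ij; apply: H; exists i, j.
  have [lt|lt|/val_inj ei] := ltngtP i j.
  - by exists i, j.
  - by exists j, i.
  - by rewrite ei eqxx in ij.
(* One colliding pair already pays for [s]; all other terms are nonnegative. *)
rewrite (bigD1 j) //= (bigD1 i) //= sij eqxx -addrA lerDl addr_ge0 //.
  exact: sumr_ge0.
by apply: sumr_ge0 => k _; apply: sumr_ge0.
Qed.

(** * Random relabelling and indistinguishability *)

Definition relabel (R : realType) (n : nat) (A : {ffun 'I_n -> R})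
    (g : {perm 'I_n}) : {ffun 'I_n -> R} := [ffun i => A (g i)].

Lemma lp_far_relabel (R : realType) (n : nat) (p eps : R)
    (A : {ffun 'I_n -> R}) (g : {perm 'I_n}) :
  lp_far p eps A -> lp_far p eps (relabel A g).
Proof.
have re (F : 'I_n -> R) : \sum_i F (g i) = \sum_i F i.
  by rewrite [RHS](reindex_inj (@perm_inj _ g)).
move=> [[A0 A1] far]; split; first split.
- by move=> i; rewrite ffunE.
- by rewrite -A1 -[RHS]re; apply: eq_bigr => i _; rewrite ffunE.
- apply: le_trans far _; rewrite /lpnorm -[X in X `^ _ <= _]re le_eqVlt; apply/orP; left.
  by apply/eqP; congr (_ `^ _); apply: eq_bigr => i _; rewrite !ffunE.
Qed.

(** A permutation [h] carries [s] to [t], and multiplication by [h] only reorders the sum over the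
    group. *)
Lemma sum_relabel_uniq (R : realType) (n m : nat) (A : {ffun 'I_n -> R})
    (s t : m.-tuple 'I_n) :
  uniq s -> uniq t ->
  \sum_(g : {perm 'I_n}) iid_prob (relabel A g) s =
  \sum_(g : {perm 'I_n}) iid_prob (relabel A g) t.
Proof.
move=> us ut; have [h sh] := perm_of_uniq_tuples us ut.
rewrite (reindex_inj (mulgI h)) /=; apply: eq_bigr => g _.
by apply: eq_bigr => j _; rewrite !ffunE permM sh.
Qed.

(* [t] is a test between [u] and [v]; as [u <= v] on [P], its success on [P]
   is at most the [v]-mass of [P]. *)
Lemma two_point_bound (R : realType) (S : finType) (P : pred S)
    (u v t : S -> R) :
  (forall s, 0 <= u s) -> (forall s, 0 <= v s) -> (forall s, 0 <= t s <= 1) ->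
  \sum_s v s = 1 -> {in P, forall s, u s <= v s} ->
  \sum_s u s * t s + \sum_s v s * (1 - t s) <= 1 + \sum_(s | ~~ P s) u s.
Proof.
move=> u0 v0 t01 v1 uv; rewrite -[X in _ <= X + _]v1 [X in _ <= _ + X]big_mkcond -!big_split.
apply: ler_sum => s _ /=.
have /andP[? ?] := t01 s; have ? := u0 s; have ? := v0 s.
case: ifPn => [_|/negPn Ps]; first by nra.
by have := uv s Ps; nra.
Qed.

(** The difference is the sum of squared deviations of [A] from its mean. Hence one collision bound
    serves both laws compared below. *)
Lemma sum_sqr_unif (R : realType) (n : nat) (A : {ffun 'I_n -> R}) :
  is_distr A -> \sum_i unif R n i ^+ 2 <= \sum_i A i ^+ 2.
Proof.
case: n A => [|n] A [_ A1]; first by rewrite !big_ord0.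
rewrite -subr_ge0 -sumrB.
have -> : \sum_i (A i ^+ 2 - unif R n.+1 i ^+ 2) =
    \sum_i (A i - n.+1%:R^-1) ^+ 2 + 2 * n.+1%:R^-1 * \sum_i (A i - n.+1%:R^-1).
  rewrite mulr_sumr -big_split; apply: eq_bigr => i _ /=.
  by rewrite ffunE; ring.
rewrite sumrB A1 sumr_const card_ord -[_^-1 *+ _]mulr_natr mulVf ?pnatr_eq0 // subrr mulr0.
by rewrite addr0; apply: sumr_ge0 => i _; apply: sqr_ge0.
Qed.

Lemma is_distr_unif (R : realType) (n : nat) : (0 < n)%N -> is_distr (unif R n).
Proof.
move=> n0; split=> [i|]; first by rewrite ffunE invr_ge0.
under eq_bigr do rewrite ffunE.
by rewrite sumr_const card_ord -[_^-1 *+ _]mulr_natr mulVf ?pnatr_eq0 // -lt0n.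
Qed.

Lemma testing_needs_collisions (R : realType) (n m : nat) (p eps delta : R)
    (T : algorithm R n m) (A : {ffun 'I_n -> R}) :
  (0 < n)%N -> is_algorithm T -> solves_uniformity_testing p eps delta T ->
  lp_far p eps A ->
  1 - 2 * delta <= 'C(m, 2)%:R * \sum_i A i ^+ 2.
Proof.
move=> n0 hT [yesT noT] farA.
have far g := lp_far_relabel g farA; have dr g := (far g).1.
have dU := is_distr_unif R n0.
pose N : R := #|{perm 'I_n}|%:R.
have N0 : 0 < N by rewrite ltr0n; apply/card_gt0P; exists 1%g.
pose u (s : m.-tuple 'I_n) := iid_prob (unif R n) s.
(* The law of the samples when [A] is first relabelled by a uniformly random permutation. *)
pose v (s : m.-tuple 'I_n) := N^-1 * \sum_(g : {perm 'I_n}) iid_prob (relabel A g) s.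
have avgE (x : R) : N^-1 * \sum_(g : {perm 'I_n}) x = x.
  by rewrite sumr_const -[x *+ _]mulr_natr mulrCA mulVf ?mulr1 // gt_eqF.
have u0 s : 0 <= u s by apply: iid_prob_ge0.
have v0 s : 0 <= v s.
  by rewrite mulr_ge0 ?invr_ge0 ?(ltW N0) // sumr_ge0 // => g _; apply: iid_prob_ge0.
have u1 : \sum_s u s = 1 by apply: sum_iid_prob.
have v1 : \sum_s v s = 1.
  rewrite -mulr_sumr exchange_big /= -[RHS]avgE; congr (_ * _).
  by apply: eq_bigr => g _; apply: sum_iid_prob.
have ucol : \sum_(s : m.-tuple 'I_n | ~~ uniq s) u s <= 'C(m, 2)%:R * \sum_i A i ^+ 2.
  apply: le_trans (collision_prob _ dU) _.
  by rewrite ler_wpM2l // //; exact: sum_sqr_unif farA.1.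
have vcol : \sum_(s : m.-tuple 'I_n | ~~ uniq s) v s <= 'C(m, 2)%:R * \sum_i A i ^+ 2.
  rewrite -mulr_sumr exchange_big /= -[leRHS]avgE ler_wpM2l ?invr_ge0 ?(ltW N0) //.
  apply: ler_sum => g _; apply: le_trans (collision_prob _ (dr g)) _.
  rewrite ler_wpM2l // [leRHS](reindex_inj (@perm_inj _ g)) le_eqVlt.
  by apply/orP; left; apply/eqP/eq_bigr => i _; rewrite ffunE.
have yes : 1 - delta <= \sum_s u s * T s true by [].
(* Every relabelled copy is far from uniform, so the guarantee survives averaging. *)
have no : 1 - delta <= \sum_s v s * T s false.
  rewrite -[leLHS]avgE.
  rewrite [leRHS](_ : _ = N^-1 * \sum_(g : {perm 'I_n}) output_prob T (relabel A g) false).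
    rewrite ler_wpM2l ?invr_ge0 ?(ltW N0) //; apply: ler_sum => g _.
    exact/noT/far.
  rewrite /output_prob exchange_big mulr_sumr; apply: eq_bigr => s _ /=.
  by rewrite /v -mulrA mulr_suml.
have TF s : T s false = 1 - T s true.
  by have [_] := hT s; rewrite big_bool /= => <-; rewrite addrAC subrr add0r.
have TT s : T s true = 1 - T s false by rewrite TF; ring.
have T01 b s : 0 <= T s b <= 1.
  have [T0 _] := hT s; rewrite T0 /=.
  by have := T0 false; have := T0 true; rewrite TF; case: b => /=; rewrite ?TF; lra.
have uconst (s t : m.-tuple 'I_n) : uniq s -> uniq t -> u s = u t.
  by move=> _ _; apply: eq_bigr => j _; rewrite !ffunE.
have vconst (s t : m.-tuple 'I_n) : uniq s -> uniq t -> v s = v t.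
  by move=> us ut; congr (_ * _); apply: sum_relabel_uniq.
pose P := [pred s : m.-tuple 'I_n | uniq s].
(* Both laws are constant on repetition-free sequences, so comparing them at one such sequence
   settles all. Which law is larger does not matter: the two-point bound is symmetric up to swapping
   the outputs. *)
have : {in P, forall s, u s <= v s} \/ {in P, forall s, v s <= u s}.
  have [[s [us lt]]|H] := pselect (exists s : m.-tuple 'I_n, uniq s /\ u s < v s).
    left=> t ut; rewrite (uconst t s) // (vconst t s) //; exact: ltW.
  by right=> t ut; rewrite leNgt; apply/negP => lt; apply: H; exists t.
case=> le.
  (* The two success probabilities sum to at least [2 * (1 - delta)] and to at most one plus the
     collision mass. *)
  have := two_point_bound u0 v0 (T01 true) v1 le.
  under [X in _ + X]eq_bigr do rewrite -TF.
  by move=> /=; lra.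
have := two_point_bound v0 u0 (T01 false) u1 le.
under [X in _ + X]eq_bigr do rewrite -TT.
by move=> /=; lra.
Qed.

(** * Distributions far from uniform *)

Definition unif_on (R : realType) (n k : nat) : {ffun 'I_n -> R} :=
  [ffun i : 'I_n => if (i < k)%N then k%:R^-1 else 0].

Lemma sum_unif_on (R : realType) (n k : nat) (F : R -> R) :
  (k <= n)%N -> F 0 = 0 -> \sum_i F (unif_on R n k i) = k%:R * F k%:R^-1.
Proof.
move=> kn F0; transitivity (\sum_(i < n | (i < k)%N) F k%:R^-1).
  by rewrite [RHS]big_mkcond; apply: eq_bigr => i _; rewrite ffunE; case: ifP.
by rewrite (big_ord_narrow kn) sumr_const card_ord mulr_natl.
Qed.

Lemma is_distr_unif_on (R : realType) (n k : nat) :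
  (0 < k <= n)%N -> is_distr (unif_on R n k).
Proof.
move=> /andP[k0 kn]; split=> [i|]; first by rewrite ffunE; case: ifP.
by rewrite (sum_unif_on (F := id)) // mulfV // pnatr_eq0 -lt0n.
Qed.

Lemma sum_sqr_unif_on (R : realType) (n k : nat) :
  (0 < k <= n)%N -> \sum_i unif_on R n k i ^+ 2 = k%:R^-1.
Proof.
move=> /andP[k0 kn]; rewrite (sum_unif_on (F := fun x => x ^+ 2)) ?expr0n //.
by rewrite expr2 mulrA mulfV ?mul1r // pnatr_eq0 -lt0n.
Qed.

(** Chord bound on [[0, 1]]: the triangle inequality for [x - c = x (1 - c) + (1 - x) (0 - c)], then
    convexity of the power. *)
Lemma powR_norm_convex (R : realType) (p c x : R) :
  1 <= p -> 0 <= x <= 1 ->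
  `|x - c| `^ p <= x * `|1 - c| `^ p + (1 - x) * `|0 - c| `^ p.
Proof.
move=> p1 /andP[x0 x1].
have := convex_powR p1 (Itv01 x0 x1) (x := `|1 - c|) (y := `|0 - c|).
rewrite !inE /= !in_itv /= !normr_ge0 => /(_ isT isT).
rewrite convRE [X in X `^ _ <= _ -> _]convRE /=.
rewrite /unstable.onem; have y0 : 0 <= 1 - x by rewrite subr_ge0.
apply: le_trans; rewrite ge0_ler_powR ?nnegrE ?(le_trans _ p1) //.
  by rewrite addr_ge0 // mulr_ge0.
rewrite -{2}(ger0_norm x0) -(ger0_norm y0) -!normrM.
apply: le_trans (ler_normD _ _).
by rewrite (_ : _ + _ = x - c) //; ring.
Qed.

(** The chord bound, summed over coordinates, depends on [A] only through its total mass, and it is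
    an equality when all coordinates are 0 or 1. *)
Lemma point_mass_farthest (R : realType) (n : nat) (p : R)
    (A : {ffun 'I_n -> R}) :
  1 <= p -> (0 < n)%N -> is_distr A ->
  lpnorm p (A - unif R n) <= lpnorm p (unif_on R n 1 - unif R n).
Proof.
move=> p1 n0 [A0 A1]; have [_ D1] := @is_distr_unif_on R n 1 n0.
have s0 (V : {ffun 'I_n -> R}) : 0 <= \sum_i `|V i| `^ p.
  by apply: sumr_ge0 => i _; apply: powR_ge0.
rewrite ge0_ler_powR ?nnegrE ?invr_ge0 ?(le_trans _ p1) //.
set f1 := `|1 - n%:R^-1 : R| `^ p; set f0 := `|0 - n%:R^-1 : R| `^ p.
have tot (B : {ffun 'I_n -> R}) : \sum_i B i = 1 ->
    \sum_i (B i * f1 + (1 - B i) * f0) = f1 + (n%:R - 1) * f0.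
  move=> B1; rewrite big_split /= -!mulr_suml sumrB B1 mul1r.
  by rewrite sumr_const card_ord.
apply: (@le_trans _ _ (f1 + (n%:R - 1) * f0)).
  rewrite -(tot A A1); apply: ler_sum => i _; rewrite !ffunE.
  apply: powR_norm_convex => //; rewrite A0 /= -A1 (bigD1 i) //= lerDl.
  exact: sumr_ge0.
rewrite -(tot _ D1); apply: ler_sum => i _; rewrite !ffunE.
by case: ifP => _; [rewrite invr1 subrr mul0r addr0 mul1r | rewrite mul0r add0r subr0 mul1r].
Qed.

(** Each of the [k] points deviates by [1/k - 1/n >= 1/(2k)], so the [p]-th power of the norm is at
    least [2^-p k^(1-p)], which the bound on [k] makes at least [eps^p]. *)
Lemma unif_on_far (R : realType) (n k : nat) (p eps : R) :
  1 < p -> 0 < eps -> (0 < k)%N -> 1 / eps `^ (p / (p - 1)) <= n%:R ->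
  k%:R * (2 * eps) `^ (p / (p - 1)) <= 1 ->
  (k <= n)%N /\ eps <= lpnorm p (unif_on R n k - unif R n).
Proof.
move=> p1 e0 k0; set q := p / (p - 1) => hn hk.
have pm0 : 0 < p - 1 by rewrite subr_gt0.
have p0 : 0 < p by lra.
have q1 : 1 <= q by rewrite ler_pdivlMr //; lra.
have kR : 0 < k%:R :> R by rewrite ltr0n.
have eq0 : 0 < eps `^ q by apply: powR_gt0.
(* The hypotheses give [n >= eps^-q >= 2^q k], and [q >= 1]. *)
have n2k : 2 * k%:R <= n%:R :> R.
  apply: le_trans hn; rewrite ler_pdivlMr //.
  apply: le_trans hk; rewrite powRM ?(ltW e0) // mulrA ler_pM2r //.
  rewrite mulrC ler_pM2l //.
  by rewrite -[leLHS]powRr1 // ler_powR // ler1n.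
have nR : 0 < n%:R :> R by lra.
have kn : (k <= n)%N by rewrite -(ler_nat R); lra.
split=> //.
have hinv : (2 * k%:R)^-1 <= k%:R^-1 - n%:R^-1 :> R.
  have : n%:R^-1 <= (2 * k%:R)^-1 :> R by rewrite lef_pV2 ?posrE // mulr_gt0.
  have -> : k%:R^-1 = 2 * (2 * k%:R)^-1 :> R by field; rewrite gt_eqF.
  lra.
have main : eps `^ p <= \sum_i `|(unif_on R n k - unif R n) i| `^ p.
  apply: (@le_trans _ _ (\sum_(i < n | (i < k)%N) (2 * k%:R)^-1 `^ p)).
    rewrite (big_ord_narrow kn) sumr_const card_ord -[_ *+ k]mulr_natl.
    have -> : eps = 2^-1 * (2 * eps) by field.
    rewrite invfM (powRM _ _ (y := 2 * eps)) ?invr_ge0 ?mulr_ge0 ?(ltW e0) //.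
    rewrite (powRM _ _ (y := k%:R^-1)) ?invr_ge0 // mulrCA.
    rewrite ler_pM2l ?powR_gt0 ?invr_gt0 //.
    have -> : k%:R^-1 `^ p = k%:R^-1 `^ (p - 1) * k%:R^-1 :> R.
      rewrite -[X in _ * X]powRr1 ?invr_ge0 // -powRD ?subrK //.
      by rewrite invr_eq0 (gt_eqF kR) implybT.
    rewrite mulrCA mulfV ?gt_eqF // mulr1.
    (* Conjugacy of the exponents turns [(2 eps)^p] into [((2 eps)^q)^(p-1)], to be compared with
       [(1/k)^(p-1)]. *)
    have pE : p = q * (p - 1) by rewrite /q mulfVK // gt_eqF.
    rewrite [X in _ `^ X <= _]pE powRrM ge0_ler_powR ?nnegrE ?powR_ge0 ?invr_ge0 ?(ltW pm0) //.
    by rewrite -[leRHS]mul1r ler_pdivlMr // mulrC.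
  rewrite big_mkcond; apply: ler_sum => i _.
  case: ifP => ik; last exact: powR_ge0.
  rewrite !ffunE ik ge0_ler_powR ?nnegrE ?(ltW p0) ?invr_ge0 ?mulr_ge0 //.
  by rewrite (le_trans hinv) // ler_norm.
rewrite -[leLHS](powRr1 (ltW e0)) -(mulfV (lt0r_neq0 p0)) powRrM.
by rewrite ge0_ler_powR ?nnegrE ?powR_ge0 ?invr_ge0 ?(ltW p0) // (le_trans _ main) ?powR_ge0.
Qed.

(** * Choice of the support size and rounding *)

Theorem theorem11 (R : realType) (p q eps delta : R) (n m : nat)
    (T : algorithm R n m)
    (hp1 : 1 < p) (hp2 : p <= 2) (hq : q = p / (p - 1))
    (heps0 : 0 < eps) (heps1 : eps < 1)
    (hdelta0 : 0 < delta) (hdelta1 : delta < 1 / 2)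
    (hn : 1 / eps `^ q <= n%:R)
    (hfar : exists A : {ffun 'I_n -> R}, lp_far p eps A)
    (hT : is_algorithm T)
    (hsolves : solves_uniformity_testing p eps delta T) :
  Num.sqrt (2 * (1 - 2 * delta) * (1 / (2 * eps) `^ q)) <= m%:R.
Proof.
set K := 1 / (2 * eps) `^ q.
have Kden : 0 < (2 * eps) `^ q by rewrite powR_gt0 // mulr_gt0.
have K0 : 0 < K by rewrite divr_gt0.
have n0 : (0 < n)%N.
  by rewrite -(ltr0n R); apply: lt_le_trans hn; rewrite divr_gt0 // powR_gt0.
have [k [k0 kn Kk far]] : exists k : nat,
    [/\ (0 < k)%N, (k <= n)%N, K <= k%:R + 1 & eps <= lpnorm p (unif_on R n k - unif R n)].
  have [K1|K1] := ltP K 1.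
    (* The point mass inherits its distance from the far distribution supplied by [hfar]. *)
    exists 1%N; split=> //; first by rewrite (le_trans (ltW K1)) // lerDl.
    have [A [dA fA]] := hfar; apply: le_trans fA _.
    exact/point_mass_farthest/dA/n0/ltW.
  have /andP[lo hi] := truncn_itv (ltW K0).
  have k0 : (0 < Num.trunc K)%N.
    by rewrite lt0n; apply: contraTneq hi => ->; rewrite -leNgt.
  have [] := @unif_on_far R n (Num.trunc K) p eps hp1 heps0 k0; rewrite -?hq //.
    by rewrite -ler_pdivlMr.
  by move=> kn far; exists (Num.trunc K); split=> //; rewrite natr1 ltW.
have dk : (0 < k <= n)%N by rewrite k0.
have := testing_needs_collisions n0 hT hsolves (conj (@is_distr_unif_on R n k dk) far).
rewrite sum_sqr_unif_on // ler_pdivlMr ?ltr0n // => col.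
have k1 : 1 <= k%:R :> R by rewrite ler1n.
(* As [delta < 1/2], the collision count is positive, hence [m >= 2]. *)
have col0 : 0 < 'C(m, 2)%:R :> R by apply: lt_le_trans col; rewrite mulr_gt0 //; lra.
have m2 : (2 <= m)%N by rewrite -bin_gt0 -(ltr0n R).
have mR : 2 <= m%:R :> R by rewrite ler_nat.
have binE : 2 * 'C(m, 2)%:R = m%:R * (m%:R - 1) :> R.
  rewrite -[1]/(1%:R) -natrB ?(ltnW m2) // -!natrM; congr (_%:R).
  by rewrite -mul_bin_diag bin1 subn1.
rewrite -[leRHS]ger0_norm // -sqrtr_sqr ler_wsqrtr //.
have : 2 * (1 - 2 * delta) * K <= 2 * (1 - 2 * delta) * (k%:R + 1).
  by rewrite ler_wpM2l //; lra.
(* In [m^2 = m (m - 1) + m], the first term is at least [2 (1 - 2 delta) k] and the second at least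
   [2 >= 2 (1 - 2 delta)]. *)
by rewrite expr2; lra.
Qed.
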